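(* Let $f,u\colon\mathbb{R}^n\to\mathbb{R}$ be directionally differentiable in the sense of Hadamard, let $\Omega=\{x\in\mathbb{R}^n\mid u(x)\le 0\}$ and let $x^\ast\in\Omega$. Suppose that the regularity condition $\operatorname{cl}\{K_{<}(x^\ast)\}=K_{\le}(x^\ast)$ holds at $x^\ast$. Let $E^{\ast}(f)$ be an upper exhauster of $f$ at $x^\ast$ in the sense of Hadamard and let $E_{\ast}(u)$ be a lower exhauster of $u$ at $x^\ast$ in the sense of Hadamard. If $x^\ast$ is a local maximum of $f$ on $\Omega$, then $$\bigcap_{C\in E_{\ast}(u)}\operatorname{cl}\left\{\mathbb{R}^n\setminus K^+(C)\right\}\subset \bigcup_{C\in E^{\ast}(f)}\left[-K^+(C)\right].$$
   Context: A function $\varphi\colon\mathbb{R}^n\to\mathbb{R}$ is directionally differentiable in the sense of Hadamard at $x$ if for every $g\in\mathbb{R}^n$ the finite limit $\varphi'_H(x,g)=\lim_{[\alpha,g']\to[+0,g]}\frac{\varphi(x+\alpha g')-\varphi(x)}{\alpha}$ exists. A family $E^\ast(\varphi)$ of convex compact subsets of $\mathbb{R}^n$, totally bounded (i.e. all its members are contained in one common ball), is an upper exhauster of $\varphi$ at $x$ in the sense of Hadamard if $\varphi'_H(x,g)=\min_{C\in E^\ast(\varphi)}\max_{v\in C}\langle v,g\rangle$ for all $g\in\mathbb{R}^n$. A totally bounded family $E_\ast(\varphi)$ of convex compact subsets of $\mathbb{R}^n$ is a lower exhauster of $\varphi$ at $x$ in the sense of Hadamard if $\varphi'_H(x,g)=\max_{C\in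 E_\ast(\varphi)}\min_{w\in C}\langle w,g\rangle$ for all $g\in\mathbb{R}^n$. The minima and maxima over the families are attained. Members of the families are nonempty sets. For $x\in\mathbb{R}^n$, $K_{<}(x)=\{g\in\mathbb{R}^n\mid u'_H(x,g)<0\}$ and $K_{\le}(x)=\{g\in\mathbb{R}^n\mid u'_H(x,g)\le 0\}$. For a convex compact set $C$, $K(C)=\operatorname{cone}\{C\}$ is the conic hull of $C$, and $K^+(C)=\{g\in\mathbb{R}^n\mid\langle v,g\rangle\ge 0\ \forall v\in K(C)\}$ is the conjugate cone of $K(C)$. $\operatorname{cl}$ denotes closure. *)

(* Defs.v *)
From HB Require Import structures.
From mathcomp Require Import all_boot all_order all_algebra.
From mathcomp Require Import all_classical all_reals all_analysis.

Set Implicit Arguments.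
Unset Strict Implicit.
Unset Printing Implicit Defensive.

Import Order.TTheory GRing.Theory Num.Theory.
Import numFieldNormedType.Exports.

Local Open Scope classical_set_scope.
Local Open Scope ring_scope.

(* R^n is 'rV[R]_n for R : realType. The library topology on 'rV[R]_n comes   *)
(* from the sup norm; open, closed, compact and bounded sets are the same as  *)
(* for the Euclidean norm.                                                    *)

Definition dot (R : realType) (n : nat) (v g : 'rV[R]_n) : R :=
  \sum_i v 0 i * g 0 i.

Definition is_min (R : realType) (A : set R) (m : R) : Prop :=
  A m /\ lbound A m.

Definition is_max (R : realType) (A : set R) (m : R) : Prop :=
  A m /\ ubound A m.

Definition hadamard_quotient (R : realType) (n : nat) (phi : 'rV[R]_n -> R)
    (x : 'rV[R]_n) (p : R * 'rV[R]_n) : R :=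
  (phi (x + p.1 *: p.2) - phi x) / p.1.

(* The limit is joint in the step and in the direction: the filter is the     *)
(* product of the right neighbourhoods of 0 with the full (not punctured)     *)
(* neighbourhoods of g.                                                       *)
Definition hadamard_derivable (R : realType) (n : nat) (phi : 'rV[R]_n -> R)
    (x : 'rV[R]_n) : Prop :=
  forall g : 'rV[R]_n, cvg (hadamard_quotient phi x @ filter_prod 0^'+ (nbhs g)).

(* Meaningful only where the limit exists, since lim is a total function.     *)
Definition hadamard_derive (R : realType) (n : nat) (phi : 'rV[R]_n -> R)
    (x g : 'rV[R]_n) : R :=
  lim (hadamard_quotient phi x @ filter_prod 0^'+ (nbhs g)).

Definition totally_bounded_family (R : realType) (n : nat)
    (E : set (set 'rV[R]_n)) : Prop :=
  bounded_set (\bigcup_(C in E) C).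

Definition exhauster_family (R : realType) (n : nat)
    (E : set (set 'rV[R]_n)) : Prop :=
  (forall C, E C -> [/\ C !=set0, convex_set C & compact C]) /\
  totally_bounded_family E.

(* Minima and maxima are required to be attained, both over the members and   *)
(* over the family; in particular the family is nonempty.                     *)
Definition upper_exhauster (R : realType) (n : nat) (phi : 'rV[R]_n -> R)
    (x : 'rV[R]_n) (E : set (set 'rV[R]_n)) : Prop :=
  exhauster_family E /\
  forall g, is_min [set m | exists2 C, E C & is_max [set dot v g | v in C] m]
                   (hadamard_derive phi x g).

Definition lower_exhauster (R : realType) (n : nat) (phi : 'rV[R]_n -> R)
    (x : 'rV[R]_n) (E : set (set 'rV[R]_n)) : Prop :=
  exhauster_family E /\
  forall g, is_max [set m | exists2 C, E C & is_min [set dot w g | w in C] m]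
                   (hadamard_derive phi x g).

Definition K_lt (R : realType) (n : nat) (u : 'rV[R]_n -> R) (x : 'rV[R]_n) :
    set 'rV[R]_n :=
  [set g | hadamard_derive u x g < 0].

Definition K_le (R : realType) (n : nat) (u : 'rV[R]_n -> R) (x : 'rV[R]_n) :
    set 'rV[R]_n :=
  [set g | hadamard_derive u x g <= 0].

(* All finite nonnegative combinations, including the empty one: 0 belongs to *)
(* the cone.                                                                  *)
Definition cone (R : realType) (n : nat) (C : set 'rV[R]_n) : set 'rV[R]_n :=
  [set x | exists (k : nat) (a : 'I_k -> R) (v : 'I_k -> 'rV[R]_n),
    [/\ forall i, 0 <= a i, forall i, C (v i) & x = \sum_i a i *: v i]].

Definition conjugate_cone (R : realType) (n : nat) (K : set 'rV[R]_n) :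
    set 'rV[R]_n :=
  [set g | forall v, K v -> 0 <= dot v g].

Definition K_plus (R : realType) (n : nat) (C : set 'rV[R]_n) : set 'rV[R]_n :=
  conjugate_cone (cone C).

Definition local_max_on (R : realType) (n : nat) (f : 'rV[R]_n -> R)
    (A : set 'rV[R]_n) (x : 'rV[R]_n) : Prop :=
  A x /\ \forall y \near x, A y -> f y <= f x.

(* Main.v *)
Require Import Defs.
From HB Require Import structures.
From mathcomp Require Import all_boot all_order all_algebra.
From mathcomp Require Import all_classical all_reals all_analysis.

Set Implicit Arguments.
Unset Strict Implicit.
Unset Printing Implicit Defensive.

Import Order.TTheory GRing.Theory Num.Theory.
Import numFieldNormedType.Exports.
Local Open Scope classical_set_scope.
Local Open Scope ring_scope.

(* The Hadamard derivative of [u] is the largest of the minima of [dot w g] over the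
   lower exhauster, so membership of [g] in every [closure (~` K_plus C)] forces it to
   be nonpositive, i.e. [g] lies in [K_le], which regularity turns into [closure K_lt].
   Directions of [K_lt] are feasible for small steps, and [f] does not increase along
   them at a local maximum; since the Hadamard limit is joint in the step and the
   direction, this passes to the derivative of [f] at [g]. The member of the upper
   exhauster attaining that derivative then contains [- g] in its conjugate cone. *)

Lemma dotDr (R : realType) (n : nat) (v g h : 'rV[R]_n) :
  dot v (g + h) = dot v g + dot v h.
Proof. by rewrite /dot -big_split; apply: eq_bigr => i _; rewrite mxE mulrDr. Qed.

Lemma dotNr (R : realType) (n : nat) (v g : 'rV[R]_n) : dot v (- g) = - dot v g.
Proof. by rewrite /dot -sumrN; apply: eq_bigr => i _; rewrite mxE mulrN. Qed.

Lemma dot_sumZl (R : realType) (n k : nat) (a : 'I_k -> R)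
    (v : 'I_k -> 'rV[R]_n) (g : 'rV[R]_n) :
  dot (\sum_i a i *: v i) g = \sum_i a i * dot (v i) g.
Proof.
rewrite /dot; under eq_bigr do rewrite summxE mulr_suml.
rewrite exchange_big /=; apply: eq_bigr => j _; rewrite mulr_sumr.
by apply: eq_bigr => i _; rewrite mxE mulrA.
Qed.

Lemma ler_norm_dot (R : realType) (n : nat) (v g : 'rV[R]_n) :
  `|dot v g| <= n%:R * (`|v| * `|g|).
Proof.
apply: le_trans (ler_norm_sum _ _ _) _.
rewrite -[n in n%:R]card_ord mulr_natl -sumr_const; apply: ler_sum => i _.
have coordle (w : 'rV[R]_n) : `|w 0 i| <= `|w|.
  by rewrite [leRHS]/Num.norm /= mx_normrE (le_bigmax _ _ (0, i)).
by rewrite normrM ler_pM.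
Qed.

Lemma K_plusE (R : realType) (n : nat) (C : set 'rV[R]_n) :
  K_plus C = [set g | forall v, C v -> 0 <= dot v g].
Proof.
apply/seteqP; split => g /= Kg v.
  move=> Cv; apply: Kg; exists 1%N, (fun=> 1), (fun=> v).
  by split=> //; rewrite big_ord1 scale1r.
move=> [k [a [w [a0 Cw ->]]]]; rewrite dot_sumZl.
by apply: sumr_ge0 => i _; rewrite mulr_ge0 ?Kg.
Qed.

(** If [m] were positive, boundedness of [C] would keep [dot v h] nonnegative for all [v] in [C] and
    all [h] close to [g], so a whole ball around [g] would lie in [K_plus C]. *)
Lemma closure_setC_K_plus (R : realType) (n : nat) (C : set 'rV[R]_n)
    (g : 'rV[R]_n) (m : R) :
  bounded_set C -> lbound [set dot w g | w in C] m ->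
  closure (~` K_plus C) g -> m <= 0.
Proof.
move=> [M [_ bM]] lbm clg; rewrite leNgt; apply/negP => m0.
have M0 : 0 < `|M| + 1 by rewrite ltr_wpDl.
have CM w : C w -> `|w| <= `|M| + 1.
  by move=> Cw; apply: bM Cw; rewrite (le_lt_trans (ler_norm _)) ?ltrDl.
(* A Lipschitz constant for [dot v], uniform in [v] in [C]; [n.+1] keeps it positive when [n] is
   0. *)
pose K := n.+1%:R * (`|M| + 1).
have K0 : 0 < K by rewrite mulr_gt0.
have [h [Kh /=]] := clg _ (nbhsx_ballx g (m / K) (divr_gt0 m0 K0)).
rewrite -ball_normE /= distrC ltr_pdivlMr// => gh; apply: Kh.
rewrite K_plusE /= => v Cv.
have mv : m <= dot v g by apply: lbm; exists v.
have : `|dot v (h - g)| <= m.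
  apply: le_trans (ler_norm_dot _ _) _; apply: le_trans (ltW gh).
  rewrite [leRHS]mulrC /K -mulrA ler_pM ?mulr_ge0 ?ler_nat//.
  by rewrite ler_wpM2r ?CM.
rewrite ler_norml => /andP[mhg _].
by rewrite -(subrK g h) dotDr -(addNr m) lerD.
Qed.

Lemma hadamard_derive_le0 (R : realType) (n : nat) (f u : 'rV[R]_n -> R)
    (x g : 'rV[R]_n) :
  (forall h, hadamard_derivable f h) -> (forall h, hadamard_derivable u h) ->
  local_max_on f [set y | u y <= 0] x -> closure (K_lt u x) g ->
  hadamard_derive f x g <= 0.
Proof.
move=> hf hu [/= ux0 fmax] clg; rewrite leNgt; apply/negP => fg0.
have [[/= P Q] [/= P0 Qg] PQ] := cvgr_gt _ (hf x g) _ fg0.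
(* [Q] allows any direction near [g], so [g] can be traded for some [h] in [K_lt u x] while the
   quotients of [f] stay positive. *)
have [h [/= uh0 Qh]] := clg _ Qg.
have [[/= P' Q'] [/= P'0 Q'h] PQ'] := cvgr_lt _ (hu x h) _ uh0.
have xah : (fun a : R => x + a *: h) @ 0^'+ --> x.
  rewrite -[X in _ --> X]addr0 -(scale0r h); apply: cvg_at_right_filter.
  by apply: cvgD; [exact: cvg_cst | apply: cvgZr_tmp; exact: cvg_id].
(* One step [a] serves both quotients: [u] decreases, so the point is feasible, yet [f]
   increases. *)
have [a [[[Pa P'a] a0] fmaxa]] : exists a : R,
    ((P a /\ P' a) /\ 0 < a) /\ (u (x + a *: h) <= 0 -> f (x + a *: h) <= f x).
  apply: (@filter_ex R 0^'+); near=> a; split; [split; [split|]|]; near: a.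
  - exact: P0.
  - exact: P'0.
  - exact: nbhs_right_gt.
  - exact: xah fmax.
have := PQ (a, h) (conj Pa Qh); rewrite /hadamard_quotient /= pmulr_lgt0 ?invr_gt0//.
rewrite subr_gt0 ltNge fmaxa//; apply: le_trans ux0; apply: ltW.
have := PQ' (a, h) (conj P'a (nbhs_singleton Q'h)).
by rewrite /hadamard_quotient /= pmulr_llt0 ?invr_gt0// subr_lt0.
Unshelve. all: by end_near. Qed.

Theorem theorem13 (R : realType) (n : nat) (f u : 'rV[R]_n -> R)
    (hf : forall x, hadamard_derivable f x)
    (hu : forall x, hadamard_derivable u x)
    (Omega : set 'rV[R]_n) (hOmega : Omega = [set x | u x <= 0])
    (xs : 'rV[R]_n) (hxs : Omega xs)
    (hreg : closure (K_lt u xs) = K_le u xs)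
    (Ef : set (set 'rV[R]_n)) (hEf : upper_exhauster f xs Ef)
    (Eu : set (set 'rV[R]_n)) (hEu : lower_exhauster u xs Eu)
    (hmax : local_max_on f Omega xs) :
  \bigcap_(C in Eu) closure (~` K_plus C) `<=`
  \bigcup_(C in Ef) [set - g | g in K_plus C].
Proof.
move=> g Kg; subst Omega.
have ug0 : hadamard_derive u xs g <= 0.
  have [[_ bEu] /(_ g) [/= [C EuC [_ lbC]] _]] := hEu.
  apply: (closure_setC_K_plus _ lbC (Kg C EuC)).
  by apply: sub_boundedr bEu => A GA w Cw; apply: GA; exists C.
have fg0 : hadamard_derive f xs g <= 0.
  apply: (hadamard_derive_le0 hf hu hmax); rewrite hreg; exact: ug0.
(* For the member [C] attaining the minimum, the derivative of [f] bounds every [dot v g] from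
   above. *)
have [_ /(_ g) [/= [C EfC [_ ubC]] _]] := hEf.
exists C => //; exists (- g); last exact: opprK.
rewrite K_plusE /= => v Cv; rewrite dotNr oppr_ge0 (le_trans _ fg0)//.
by apply: ubC; exists v.
Qed.
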